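(* The Boros-Moll sequences $\{d_i(m)\}_{0\le i\le m}$ are $2$-log-concave; that is, for all integers $m,i$ with $1\leq i\leq m-1$, $$\frac{d_{i-1}^{2}(m)-d_{i-2}(m)d_{i}(m)}{d_{i}^{2}(m)-d_{i-1}(m)d_{i+1}(m)} < \frac{d_{i}^{2}(m)-d_{i-1}(m)d_{i+1}(m)}{d_{i+1}^{2}(m)-d_{i}(m)d_{i+2}(m)}.$$
   Context: For integers $m\ge 0$ and $0\le i\le m$, the Boros-Moll numbers are $$d_i(m)=2^{-2m}\sum_{k=i}^m 2^k\binom{2m-2k}{m-k}\binom{m+k}{k}\binom{k}{i},$$ with the convention $d_i(m)=0$ for $i<0$ or $i>m$. They are the coefficients of the Boros-Moll polynomial $P_m(a)=\sum_{i=0}^m d_i(m)a^i$. The notation $d_i^{2}(m)$ means $(d_i(m))^2$. A finite real sequence $\{a_i\}_{0\le i\le n}$ (with $a_{-1}=a_{n+1}=0$) is log-concave if $a_i^2-a_{i+1}a_{i-1}\ge 0$ for $1\le i\le n$. Let $\mathcal L(\{a_i\}_{0\le i\le n})=\{b_i\}_{0\le i\le n}$ with $b_i=a_i^2-a_{i-1}a_{i+1}$. The sequence is $k$-log-concave if $\mathcal L^j(\{a_i\})$ is log-concave for every $0\le j\le k-1$. *)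

(* Defs.v *)
From HB Require Import structures.
From mathcomp Require Import all_boot all_order all_algebra.

Set Implicit Arguments.
Unset Strict Implicit.
Unset Printing Implicit Defensive.

Import Order.TTheory GRing.Theory Num.Theory.
Local Open Scope ring_scope.

(* For j > m the summation range is empty, so the value is 0 there too. *)
Definition boros_moll (R : realFieldType) (m : nat) (i : int) : R :=
  match i with
  | Posz j =>
      2 ^- (2 * m)%N *
      \sum_(j <= k < m.+1)
         2 ^+ k * ('C(2 * m - 2 * k, m - k) * 'C(m + k, k) * 'C(k, j))%N%:R
  | Negz _ => 0
  end.

(* A finite sequence (a_i), 0 <= i <= n, is a function on 'I_n.+1; [extend a]
   realizes the convention a_{-1} = a_{n+1} = 0. *)
Definition extend (R : realFieldType) (n : nat) (a : 'I_n.+1 -> R) (i : int) : R :=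
  match i with
  | Posz j => if insub j is Some k then a k else 0
  | Negz _ => 0
  end.

Definition lc_op (R : realFieldType) (n : nat) (a : 'I_n.+1 -> R) : 'I_n.+1 -> R :=
  fun i => a i ^+ 2 - extend a (i%:Z - 1) * extend a (i%:Z + 1).

Definition log_concave (R : realFieldType) (n : nat) (a : 'I_n.+1 -> R) : Prop :=
  forall i : 'I_n.+1, (1 <= i)%N ->
    0 <= a i ^+ 2 - extend a (i%:Z + 1) * extend a (i%:Z - 1).

Definition k_log_concave (R : realFieldType) (k n : nat) (a : 'I_n.+1 -> R) : Prop :=
  forall j : nat, (j < k)%N -> log_concave (iter j (@lc_op R n) a).

(* Main.v *)
(* Put v_i = i d_i / d_(i-1) and P_i = (i+1) v_i - i v_(i+1).  The three-term
   recurrence of d_i(m) in i (creative telescoping) becomes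
   v_i (2m+1 - v_(i+1)) = (m+1-i)(m+i), and 2-log-concavity becomes
     i v_(i+1) P_(i-1) P_(i+1) < (i+2) v_(i-1) P_i^2.
   The defect e_i = m+1-i - v_i turns out to be nonnegative, nonincreasing and
   convex in i: each property propagates from i+1 to i through the recurrence,
   starting from e_(m+1) = 0.  Monotonicity makes v decreasing, convexity makes
   P nondecreasing, and the quantitative lower bound on v_i - v_(i+1) obtained
   along the way gives i P_(i+1) < (i+2) P_i, whence the inequality. *)
Require Import Defs.
From HB Require Import structures.
From mathcomp Require Import all_boot all_order all_algebra.
From mathcomp Require Import zify ring lra.

Set Implicit Arguments.
Unset Strict Implicit.
Unset Printing Implicit Defensive.

Import Order.TTheory GRing.Theory Num.Theory.
Local Open Scope ring_scope.

Lemma central_bin_rec n :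
  (n.+1 * 'C(2 * n.+1, n.+1) = 2 * (2 * n).+1 * 'C(2 * n, n))%N.
Proof.
have e1 : (2 * n.+1 = (2 * n).+2)%N by lia.
have h1 := mul_bin_diag (2 * n).+2 n; have h2 := mul_bin_down (2 * n).+1 n.
rewrite e1 -h1 /=; rewrite /= in h2.
have e2 : ((2 * n).+1 - n = n.+1)%N by lia.
rewrite e2 in h2; nia.
Qed.

(** * Real inequalities between consecutive defects *)

Section Defect.
Variables (R : realFieldType) (m : R).

(* With [x = e_(i+1)]: the second bound says [e_(i+2) <= e_(i+1)], the third that
   [e_i - e_(i+1) >= e_(i+1) - e_(i+2)], each eliminating the other defects by
   the recurrence. *)
Definition defect_inv (i x : R) : Prop :=
  [/\ 0 <= x, x ^+ 2 + 2 * (i + 1) * x <= m - i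
    & 2 * i * (m - i - x) <= x * (x + 2 * i + 1) * (2 * x + 2 * i + 1)].

(** Here [x] is e_(i+1) and [f] is e_(i+2), so [1 + f - x] is the drop v_(i+1) - v_(i+2); the last
    bound is the quantitative one. *)
Lemma defect_step (i x f : R) : 0 <= i -> i + 1 <= m -> 0 < m - i - x ->
  x * (m + i + 2 + f) = (m - i) * (1 + f) -> defect_inv (i + 1) f ->
  [/\ defect_inv i x, f <= x, x < 1 + f
    & 2 * (i + 1) <= (1 + f - x) * (2 * f + 2 * i + 3)].
Proof.
move=> i0 im v0 xf [f0 fU fH].
have p0 : 0 < m + i + 2 + f by lra.
have x0 : 0 <= x.
  by rewrite -(pmulr_lge0 _ p0) xf; apply: mulr_ge0; lra.
have fx : f <= x.
  rewrite -(ler_pM2r p0) xf -subr_ge0.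
  have -> : (m - i) * (1 + f) - f * (m + i + 2 + f)
     = m - (i + 1) - (f ^+ 2 + 2 * (i + 1 + 1) * f) + 1 + 2 * f by ring.
  lra.
have dE : (1 + f - x) * (m + i + 2 + f) = f * (f + 2 * i + 3) + 2 * (i + 1).
  by rewrite mulrBl xf; ring.
have d0 : 0 < 1 + f - x.
  rewrite -(pmulr_lgt0 _ p0) dE; apply: ltr_wpDl; last by lra.
  by apply: mulr_ge0; lra.
(* Multiplied by [m + i + 2 + f], this is the third bound of [defect_inv (i + 1) f]. *)
have G : 2 * (i + 1) <= (1 + f - x) * (2 * f + 2 * i + 3).
  rewrite -(ler_pM2r p0) [leRHS]mulrAC dE -subr_ge0.
  have -> : (f * (f + 2 * i + 3) + 2 * (i + 1)) * (2 * f + 2 * i + 3)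
        - 2 * (i + 1) * (m + i + 2 + f)
     = f * (f + 2 * (i + 1) + 1) * (2 * f + 2 * (i + 1) + 1)
        - 2 * (i + 1) * (m - (i + 1) - f) by ring.
  lra.
(* The recurrence again, now giving v_(i+1) times the drop in terms of [x] alone. Hence the last two
   bounds of [defect_inv i x] say that the drop is at most 1 and that [H] holds. *)
have vE : x * (x + 2 * i + 1) = (m - i - x) * (1 + f - x) by move: xf; lra.
have H : 2 * i <= (1 + f - x) * (2 * x + 2 * i + 1).
  have h : 2 * i * (2 * f + 2 * i + 3)
      <= 2 * (i + 1) * (2 * x + 2 * i + 1).
    have : 0 <= i * (x - f) by apply: mulr_ge0; lra.
    lra.
  have q0 : 0 < 2 * f + 2 * i + 3 by lra.
  rewrite -(ler_pM2r q0); apply: (le_trans h); rewrite [leRHS]mulrAC.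
  by apply: ler_wpM2r => //; lra.
split=> //; last by lra.
split=> //.
  have : 0 <= (m - i - x) * (x - f) by apply: mulr_ge0; lra.
  by move: xf; lra.
have : 0 <= (m - i - x) * ((1 + f - x) * (2 * x + 2 * i + 1) - 2 * i).
  by apply: mulr_ge0; lra.
by rewrite vE; lra.
Qed.

(* With [q = m+i+e_i], so that [v_(i-1) q = (m+2-i)(m+i-1)], the two sides are
   [i (q P_(i-1)) (v_(i+1) P_(i+1))] and [(i+2) (q v_(i-1)) P_i^2]. *)
Lemma defect_main (i e f : R) : 1 <= i -> i + 1 <= m ->
  0 < m + 1 - i - e -> 0 < m - i - f ->
  e * (m + i + 1 + f) = (m + 1 - i) * (1 + f) ->
  defect_inv (i - 1) e -> defect_inv i f ->
  f <= e -> e < 1 + f -> 2 * i <= (1 + f - e) * (2 * f + 2 * i + 1) ->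
  i * (((m + 2 - i) * (m + i - 1)) + (i - 1) * (2 * i - 2 + e * (e + 2 * i - 1)))
    * ((m - i - f) ^+ 2 + (i + 1) * (f * (f + 2 * i + 1)))
  < (i + 2) * ((m + 2 - i) * (m + i - 1)) * (m + 1 - i - e + i * (1 + f - e)) ^+ 2.
Proof.
move=> i1 im v0 w0 ef [e0 eU eH] [f0 fU fH] fe ef1 G.
(* In terms of the sequence: [v] is v_i, [w] is v_(i+1), [d] their difference, [A] is q v_(i-1) and
   [P] is P_i. *)
set d := 1 + f - e; set v := m + 1 - i - e; set w := m - i - f.
set A := (m + 2 - i) * (m + i - 1); set P := v + i * d.
have d0 : 0 < d by rewrite /d; lra.
have d1 : d <= 1 by rewrite /d; lra.
have wE : w = v - d by rewrite /w /v /d; ring.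
have vE : e * (e + 2 * i - 1) = v * d by move: ef; rewrite /v /d; lra.
have q0 : 0 < m + i + e by lra.
have P0 : 0 < P by rewrite /P; apply: addr_gt0 => //; apply: mulr_gt0 => //; lra.
have AE : A = (m + i + e) * v + (v * d + 2 * i - 2) by rewrite -vE /A /v; ring.
have vd0 : 0 < v * d by exact: mulr_gt0.
(* v_(i+1) <= v_(i-1), scaled by q. *)
have hA : w * (m + i + e) <= A.
  have : 0 < d * (m + i + e) by exact: mulr_gt0.
  by rewrite AE wE; lra.
(* P_(i-1) <= P_i, scaled by q; this is where the third bound on [e] enters. *)
have hPm : A + (i - 1) * (2 * i - 2 + e * (e + 2 * i - 1)) <= (m + i + e) * P.
  have H : 2 * (i - 1) <= d * (2 * e + 2 * i - 1).
    rewrite -(ler_pM2r v0) -/v; move: eH.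
    have -> : e * (e + 2 * (i - 1) + 1) = v * d by rewrite -vE; ring.
    by rewrite /v; lra.
  have : 0 <= i * (d * (2 * e + 2 * i - 1) - 2 * (i - 1)) by apply: mulr_ge0; lra.
  have -> : m + i + e = v + (2 * e + 2 * i - 1) by rewrite /v; ring.
  by rewrite vE AE /P /v; lra.
(* i P_(i+1) < (i+2) P_i, scaled by [w]. First P_(i+1) <= w + i + 1, because the drop v_(i+1) -
   v_(i+2) is at most 1. *)
have hPp : i * (w ^+ 2 + (i + 1) * (f * (f + 2 * i + 1))) < (i + 2) * w * P.
  have h1 : i * (w ^+ 2 + (i + 1) * (f * (f + 2 * i + 1))) <= i * w * (w + i + 1).
    have : 0 <= i * (i + 1) * (w - f * (f + 2 * i + 1)).
      by apply: mulr_ge0; [apply: mulr_ge0; lra | rewrite /w; lra].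
    lra.
  apply: (le_lt_trans h1).
  have -> : i * w * (w + i + 1) = w * (i * (w + i + 1)) by ring.
  have -> : (i + 2) * w * P = w * ((i + 2) * P) by ring.
  rewrite ltr_pM2l //.
  have s0 : 0 < 2 * f + 2 * i + 1 by lra.
  rewrite -(ltr_pM2r s0).
  have hd : (i + 1) * (i + 2) * (2 * i) <= (i + 1) * (i + 2) * (d * (2 * f + 2 * i + 1)).
    by apply: ler_wpM2l => //; apply: mulr_ge0; lra.
  (* What remains once [d] is replaced by its lower bound 2i / (2f + 2i + 1) from [G]. *)
  suff : (i + 1) * (i + 2) * (2 * f + 1) < 2 * (m + 1 - f) * (2 * f + 2 * i + 1).
    move: hd; rewrite /P wE /w /v /d; lra.
  have lb : f ^+ 2 + (2 * i + 1) * f + i + 1 <= m + 1 - f by lra.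
  apply: (@lt_le_trans _ _ (2 * (f ^+ 2 + (2 * i + 1) * f + i + 1) * (2 * f + 2 * i + 1))).
    rewrite -subr_gt0.
    have -> : 2 * (f ^+ 2 + (2 * i + 1) * f + i + 1) * (2 * f + 2 * i + 1)
         - (i + 1) * (i + 2) * (2 * f + 1)
       = 4 * f ^+ 3 + (12 * i + 6) * f ^+ 2 + (6 * i ^+ 2 + 6 * i + 2) * f
         + (3 * i ^+ 2 + 3 * i) by ring.
    by apply: ltr_wpDl; [rewrite !addr_ge0 ?mulr_ge0 ?exprn_ge0 //|]; nra.
  by apply: ler_wpM2r; lra.
set X := _ + _ * (_ + _) in hPm *; set Y := _ + _ * (_ * _) in hPp *.
have Y0 : 0 <= i * Y.
  apply: mulr_ge0; first by lra.
  by apply: addr_ge0; [exact: sqr_ge0 | do 2 (apply: mulr_ge0; first by lra)]; lra.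
have i20 : 0 < i + 2 by lra.
rewrite mulrAC mulrC.
apply: (le_lt_trans (ler_wpM2r Y0 hPm)).
apply: (@lt_le_trans _ _ ((m + i + e) * P * ((i + 2) * w * P))).
  by rewrite ltr_pM2l //; exact: mulr_gt0.
have -> : (m + i + e) * P * ((i + 2) * w * P) = (i + 2) * (w * (m + i + e)) * P ^+ 2 by ring.
apply: ler_wpM2r; first exact: sqr_ge0.
by apply: ler_wpM2l => //; exact: ltW.
Qed.
End Defect.

(** * The three-term recurrence by creative telescoping *)

Section Recurrence.
Variables (R : realFieldType) (m : nat).

(* The coefficient of [(1 + a)^k] in [2^(2m) P_m(a)]. *)
Definition bm_coef (k : nat) : R :=
  2 ^+ k * ('C(2 * m - 2 * k, m - k) * 'C(m + k, k))%N%:R.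

(** Writing m = k + n + 1 makes the first binomials central, so [central_bin_rec] gives their
    ratio. *)
Lemma bm_coefS (k : nat) : (k < m)%N ->
  (2 * m%:R - 2 * k%:R - 1) * k.+1%:R * bm_coef k.+1
  = (m%:R - k%:R) * (m%:R + k%:R + 1) * bm_coef k.
Proof.
move=> km; have [n mE] : exists n, m = (k + n).+1 by exists (m - k.+1)%N; lia.
rewrite /bm_coef exprS.
have -> : (2 * m - 2 * k.+1 = 2 * n)%N by lia.
have -> : (2 * m - 2 * k = 2 * n.+1)%N by lia.
have -> : (m - k.+1 = n)%N by lia.
have -> : (m - k = n.+1)%N by lia.
have h1 := central_bin_rec n.
have h2 : (k.+1 * 'C(m + k.+1, k.+1) = (m + k).+1 * 'C(m + k, k))%N.
  by rewrite addnS -mul_bin_diag.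
have {}h1 : n.+1%:R * 'C(2 * n.+1, n.+1)%:R
    = 2 * (2 * n%:R + 1) * 'C(2 * n, n)%:R :> R.
  by move/(congr1 (fun z => z%:R : R)): h1; rewrite !natrM -(natr1 (2 * n)%N) natrM.
have {}h2 : k.+1%:R * 'C(m + k.+1, k.+1)%:R
    = (m%:R + k%:R + 1) * 'C(m + k, k)%:R :> R.
  by move/(congr1 (fun z => z%:R : R)): h2; rewrite !natrM -(natr1 (m + k)%N) natrD.
have mR : m%:R = k%:R + n%:R + 1 :> R by rewrite mE -natr1 natrD.
rewrite !natrM.
transitivity ((2 * n%:R + 1) * (2 * 2 ^+ k) * 'C(2 * n, n)%:R
              * (k.+1%:R * 'C(m + k.+1, k.+1)%:R) : R); first by rewrite mR; ring.
rewrite h2.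
transitivity (2 ^+ k * ((m%:R + k%:R + 1) * 'C(m + k, k)%:R)
              * (n.+1%:R * 'C(2 * n.+1, n.+1)%:R) : R).
  by rewrite h1; ring.
by rewrite mR -natr1; ring.
Qed.

(** Terms with k < i vanish; a range independent of i lets sums for different i be combined
    termwise. *)
Lemma boros_mollE (i : nat) :
  boros_moll R m i%:Z = 2 ^- (2 * m)%N * \sum_(k < m.+1) bm_coef k * 'C(k, i)%:R.
Proof.
rewrite /boros_moll; congr (_ * _).
rewrite -(big_mkord xpredT (fun k => bm_coef k * 'C(k, i)%:R)).
have [im|mi] := leqP i m.+1; last first.
  rewrite [LHS]big_geq; last by lia.
  by rewrite big_nat big1 // => k km; rewrite bin_small ?mulr0 //; lia.
rewrite (@big_cat_nat _ _ _ i 0 m.+1) //=.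
rewrite [X in _ = X + _]big_nat [X in _ = X + _]big1 ?add0r => [|k ki].
  by apply: eq_bigr => k _; rewrite /bm_coef !natrM; ring.
by rewrite bin_small ?mulr0 //; lia.
Qed.

Lemma boros_moll_rec (i : nat) :
  i.+2%:R * i.+1%:R * boros_moll R m i.+2%:Z
  - i.+1%:R * (2 * m%:R + 1) * boros_moll R m i.+1%:Z
  + (m%:R - i%:R) * (m%:R + i%:R + 1) * boros_moll R m i%:Z = 0.
Proof.
rewrite !boros_mollE.
(* The telescoping certificate: for k < m the recurrence operator sends the k-th summand to G (k+1)
   - G k. *)
pose G k : R := (2 * m%:R + 1 - 2 * k%:R) * bm_coef k * (i.+1%:R * 'C(k, i.+1)%:R).
have binS k j : j.+1%:R * 'C(k, j.+1)%:R = (k%:R - j%:R) * 'C(k, j)%:R :> R.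
  have [jk|kj] := leqP j k; last by rewrite !bin_small ?mulr0 //; lia.
  by rewrite -natrB // -!natrM mul_bin_left.
set S0 := \sum_(k < m.+1) _ * 'C(_, i)%:R.
set S1 := \sum_(k < m.+1) _ * 'C(_, i.+1)%:R.
set S2 := \sum_(k < m.+1) _ * 'C(_, i.+2)%:R.
suff : i.+2%:R * i.+1%:R * S2 - i.+1%:R * (2 * m%:R + 1) * S1
       + (m%:R - i%:R) * (m%:R + i%:R + 1) * S0 = 0.
  by move=> h; rewrite -[RHS](mulr0 (2 ^- (2 * m)%N)) -[X in _ = _ * X]h; ring.
transitivity (\sum_(k < m.+1)
   ((m%:R - k%:R) * (m%:R + k%:R + 1) * bm_coef k * 'C(k, i)%:R - G k)).
  rewrite /S0 /S1 /S2 !mulr_sumr -sumrN -!big_split /=; apply: eq_bigr => k _.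
  have h1 := binS k i; have h2 := binS k i.+1; rewrite /G.
  have -> : i.+2%:R * i.+1%:R * (bm_coef k * 'C(k, i.+2)%:R)
     = i.+1%:R * bm_coef k * (i.+2%:R * 'C(k, i.+2)%:R) by ring.
  rewrite h2.
  have -> : i.+1%:R * bm_coef k * ((k%:R - i.+1%:R) * 'C(k, i.+1)%:R)
     = bm_coef k * (k%:R - i.+1%:R) * (i.+1%:R * 'C(k, i.+1)%:R) by ring.
  have -> : i.+1%:R * (2 * m%:R + 1) * (bm_coef k * 'C(k, i.+1)%:R)
     = (2 * m%:R + 1) * bm_coef k * (i.+1%:R * 'C(k, i.+1)%:R) by ring.
  by rewrite h1 -natr1; ring.
(* At k = m the factor m - k vanishes, leaving - G m; it cancels the telescoped sum, as G 0 = 0. *)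
rewrite big_ord_recr /= subrr !mul0r add0r.
rewrite (eq_bigr (fun k : 'I_m => G k.+1 - G k)) => [|k _].
  rewrite -(big_mkord xpredT (fun k => G k.+1 - G k)) telescope_sumr // /G.
  by rewrite bin0n !mulr0 subr0 subrr.
rewrite -bm_coefS // /G.
have := mul_bin_diag k.+1 i => /(congr1 (fun z => z%:R : R)); rewrite !natrM /= => <-.
by rewrite -!natr1; ring.
Qed.

Lemma boros_moll_gt0 (i : nat) : (i <= m)%N -> 0 < boros_moll R m i%:Z.
Proof.
move=> im; rewrite boros_mollE mulr_gt0 ?invr_gt0 ?exprn_gt0 //.
rewrite big_ord_recr /= ltr_wpDl //.
  by apply: sumr_ge0 => k _; rewrite !mulr_ge0 ?exprn_ge0.
by rewrite /bm_coef !natrM !mulr_gt0 ?exprn_gt0 // ltr0n bin_gt0; lia.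
Qed.

Lemma boros_moll_out (i : nat) : (m < i)%N -> boros_moll R m i%:Z = 0.
Proof. by move=> mi; rewrite /boros_moll big_geq ?mulr0. Qed.

(** * Defects of the Boros-Moll sequence *)

(* This is [e_(i+1)]. *)
Definition bm_defect (i : nat) : R :=
  m%:R - i%:R - i.+1%:R * boros_moll R m i.+1%:Z / boros_moll R m i%:Z.

Lemma bm_defect_rec (i : nat) : (i < m)%N ->
  bm_defect i * (m%:R + i%:R + 2 + bm_defect i.+1)
  = (m%:R - i%:R) * (1 + bm_defect i.+1).
Proof.
move=> im; have a0 := lt0r_neq0 (boros_moll_gt0 (ltnW im)).
have b0 := lt0r_neq0 (boros_moll_gt0 im); have := boros_moll_rec i.
rewrite /bm_defect; move: a0 b0; set a := boros_moll _ _ _.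
set b := boros_moll _ _ _; set c := boros_moll _ _ _ => a0 b0.
rewrite -!natr1 => h; apply/eqP; rewrite -subr_eq0; apply/eqP.
rewrite -(mul0r a^-1) -h; field; exact/andP.
Qed.

Lemma bm_defect_lt (i : nat) : (i < m)%N -> 0 < m%:R - i%:R - bm_defect i.
Proof.
move=> im; rewrite /bm_defect opprB addrCA subrr addr0.
apply: divr_gt0; last exact/boros_moll_gt0/ltnW.
by apply: mulr_gt0; rewrite ?boros_moll_gt0.
Qed.

Lemma bm_defectP (i : nat) : (i <= m)%N -> defect_inv m%:R i%:R (bm_defect i).
Proof.
(* Descending induction on i, run on j = m - i; the base uses d_(m+1)(m) = 0. *)
move=> im; rewrite -(subKn im); move: (m - i)%N (leq_subr i m) => j.
elim: j => [_|j IHj jm].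
  rewrite subn0 /bm_defect boros_moll_out // mulr0 mul0r !subrr.
  by split; rewrite // !(mulr0, mul0r, subr0, expr0n) ?addr0 ?subrr ?mulr0.
have im' : (m - j.+1 < m)%N by lia.
have eS : (m - j = (m - j.+1).+1)%N by lia.
move: (IHj (ltnW jm)); rewrite eS -[in defect_inv _ _.+1%:R _]natr1 => h.
have [] // := defect_step (ler0n _ _) _ (bm_defect_lt im') (bm_defect_rec im') h.
by rewrite natr1 ler_nat.
Qed.

Lemma bm_defect_stepP (i : nat) : (i < m)%N ->
  [/\ bm_defect i.+1 <= bm_defect i, bm_defect i < 1 + bm_defect i.+1
    & 2 * (i%:R + 1) <= (1 + bm_defect i.+1 - bm_defect i)
                        * (2 * bm_defect i.+1 + 2 * i%:R + 3)].
Proof.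
move=> im; have := bm_defectP im; rewrite -[in defect_inv _ _.+1%:R _]natr1 => h.
have [] // := defect_step (ler0n _ _) _ (bm_defect_lt im) (bm_defect_rec im) h.
by rewrite natr1 ler_nat.
Qed.

(** * The terms of the transformed sequence *)

Definition bm_disc (z : int) : R :=
  boros_moll R m z ^+ 2 - boros_moll R m (z - 1) * boros_moll R m (z + 1).

Lemma bm_discS (k : nat) : bm_disc k.+1%:Z
  = boros_moll R m k.+1%:Z ^+ 2 - boros_moll R m k%:Z * boros_moll R m k.+2%:Z.
Proof.
rewrite /bm_disc; have -> : k.+1%:Z - 1 = k%:Z by lia.
by have -> : k.+1%:Z + 1 = k.+2%:Z by lia.
Qed.

(** The last factor is P_(k+1). *)
Lemma bm_discE (k : nat) : (k < m)%N ->
  k.+1%:R * k.+2%:R * bm_disc k.+1%:Z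
  = boros_moll R m k%:Z * boros_moll R m k.+1%:Z
    * (m%:R - k%:R - bm_defect k
       + k.+1%:R * (1 + bm_defect k.+1 - bm_defect k)).
Proof.
move=> km; have a0 := lt0r_neq0 (boros_moll_gt0 (ltnW km)).
have b0 := lt0r_neq0 (boros_moll_gt0 km).
rewrite bm_discS /bm_defect -!natr1; field; exact/andP.
Qed.

Lemma bm_disc_gt0 (k : nat) : (k <= m)%N -> 0 < bm_disc k%:Z.
Proof.
case: k => [|k] km; first by rewrite /bm_disc mul0r subr0 exprn_gt0 // boros_moll_gt0.
have p0 : 0 < k.+1%:R * k.+2%:R :> R by rewrite mulr_gt0.
rewrite -(pmulr_rgt0 _ p0) bm_discE //.
have [_ h _] := bm_defect_stepP km.
apply: mulr_gt0.
  by apply: mulr_gt0; [exact/boros_moll_gt0/ltnW | exact: boros_moll_gt0].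
by rewrite addr_gt0 ?bm_defect_lt // mulr_gt0 // subr_gt0.
Qed.

(** The recurrence eliminates d_(k-1); with i = k + 1 the bracket is the q P_(i-1) of
    [defect_main]. *)
Lemma bm_disc_prevE (k : nat) : (k < m)%N ->
  k.+1%:R * ((m%:R + 1 - k%:R) * (m%:R + k%:R)) * bm_disc k%:Z
  = boros_moll R m k%:Z ^+ 2 * ((m%:R + 1 - k%:R) * (m%:R + k%:R)
     + k%:R * (2 * k%:R + bm_defect k * (bm_defect k + 2 * k%:R + 1))).
Proof.
move=> km; have a0 := lt0r_neq0 (boros_moll_gt0 (ltnW km)).
case: k km a0 => [|k] km a0.
  by rewrite /bm_disc mul0r subr0; ring.
have := boros_moll_rec k; rewrite bm_discS /bm_defect; move: a0.
set b := boros_moll _ _ k.+1%:Z; set a := boros_moll _ _ k%:Z.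
set c := boros_moll _ _ k.+2%:Z => b0; rewrite -!natr1 => h.
apply/eqP; rewrite -subr_eq0; apply/eqP.
(* This multiple of the recurrence accounts for the product [a * c]. *)
rewrite -[RHS](mulr0 (- (k%:R + 1 + 1) * c)) -[X in _ = _ * X]h.
by field.
Qed.

(** Here d_(k+2) is eliminated, and the bracket is v_(k+1) P_(k+1). *)
Lemma bm_disc_nextE (k : nat) : (k < m)%N ->
  k.+2%:R * k.+1%:R ^+ 2 * bm_disc k.+1%:Z
  = boros_moll R m k%:Z ^+ 2 * ((m%:R - k%:R - bm_defect k) ^+ 2
     + k.+1%:R * (bm_defect k * (bm_defect k + 2 * k%:R + 1))).
Proof.
move=> km; have a0 := lt0r_neq0 (boros_moll_gt0 (ltnW km)).
have := boros_moll_rec k; rewrite bm_discS /bm_defect; move: a0.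
set b := boros_moll _ _ k.+1%:Z; set a := boros_moll _ _ k%:Z.
set c := boros_moll _ _ k.+2%:Z => b0; rewrite -!natr1 => h.
apply/eqP; rewrite -subr_eq0; apply/eqP.
rewrite -[RHS](mulr0 (- (k%:R + 1) * a)) -[X in _ = _ * X]h.
by field.
Qed.

(** With i = k + 1, the three preceding identities turn this into [defect_main] multiplied by the
    squares of d_k and d_(k+1). *)
Lemma bm_disc_lc (k : nat) : (k.+1 < m)%N ->
  bm_disc k%:Z * bm_disc k.+2%:Z < bm_disc k.+1%:Z ^+ 2.
Proof.
move=> km; have km' : (k < m)%N := ltnW km.
have p0 := boros_moll_gt0 (ltnW km'); have q0 := boros_moll_gt0 km'.
have [fe ef1 G] := bm_defect_stepP km'.
have eI : defect_inv m%:R (k.+1%:R - 1) (bm_defect k).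
  by rewrite -natr1 addrK; exact/bm_defectP/ltnW.
have i1 : 1 <= k.+1%:R :> R by rewrite ler1n.
have im : k.+1%:R + 1 <= m%:R :> R by rewrite natr1 ler_nat.
have kE : k%:R = k.+1%:R - 1 :> R by rewrite -natr1 addrK.
have main := defect_main i1 im _ (bm_defect_lt km) _ eI (bm_defectP km') fe ef1 _.
have h0 := bm_disc_prevE km'; have h1 := bm_discE km'; have h2 := bm_disc_nextE km.
have v0 := bm_defect_lt km'; have ef := bm_defect_rec km'.
move: G main h0 h1 h2 v0 ef; rewrite -(natr1 k.+2) -(natr1 k.+1) kE.
set i : R := k.+1%:R in i1 im *; set M : R := m%:R in im *.
set p := boros_moll _ _ k%:Z in p0 *; set q := boros_moll _ _ k.+1%:Z in q0 *.
set e := bm_defect k; set f := bm_defect k.+1.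
set D0 := bm_disc k; set D1 := bm_disc k.+1; set D2 := bm_disc k.+2.
move=> G main h0 h1 h2 v0 ef.
(* A common multiple of the scaling factors on both sides. *)
have K0 : 0 < i ^+ 2 * ((M + 2 - i) * (M + i - 1)) * ((i + 2) * (i + 1) ^+ 2).
  by rewrite !mulr_gt0 ?exprn_gt0 //; lra.
rewrite -(ltr_pM2r K0).
have -> : D0 * D2 * (i ^+ 2 * ((M + 2 - i) * (M + i - 1)) * ((i + 2) * (i + 1) ^+ 2))
  = i * (i * ((M + 1 - (i - 1)) * (M + (i - 1))) * D0)
      * ((i + 1 + 1) * (i + 1) ^+ 2 * D2) by ring.
have -> : D1 ^+ 2 * (i ^+ 2 * ((M + 2 - i) * (M + i - 1)) * ((i + 2) * (i + 1) ^+ 2))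
  = (i * (i + 1) * D1) ^+ 2 * ((i + 2) * ((M + 2 - i) * (M + i - 1))) by ring.
rewrite h0 h1 h2 -subr_gt0.
have pq0 : 0 < p ^+ 2 * q ^+ 2 by rewrite mulr_gt0 ?exprn_gt0.
have {}main := main ltac:(lra) ltac:(lra) ltac:(lra).
rewrite -subr_gt0 -(pmulr_rgt0 _ pq0) in main.
by congr (0 < _): main; ring.
Qed.

End Recurrence.

(** * Zero padding and the theorem *)

(** The range -1 to n + 1 holds every neighbour of an index, so padded sequences can be traded for
    functions on the integers. *)
Lemma extendE (R : realFieldType) (n : nat) (f : int -> R) (a : 'I_n.+1 -> R) (z : int) :
  (forall i : 'I_n.+1, a i = f (i : nat)%:Z) -> f (-1) = 0 -> f n.+1%:Z = 0 ->
  -1 <= z <= n.+1%:Z -> extend a z = f z.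
Proof.
case: z => [j|[|j]] af fN fn zb /=; [|by []|by move: zb; lia].
have [jn|nj] := ltnP j n.+1; first by rewrite insubT.
rewrite insubF; last by apply/negbTE; rewrite -leqNgt.
by rewrite (_ : j = n.+1) //; move: zb; lia.
Qed.

Theorem theorem1p4 (R : realFieldType) (m : nat) :
  k_log_concave 2 (fun i : 'I_m.+1 => boros_moll R m (i : nat)%:Z) /\
  (forall i : int, 1 <= i <= m%:Z - 1 ->
     (boros_moll R m (i - 1) ^+ 2 - boros_moll R m (i - 2) * boros_moll R m i)
       / (boros_moll R m i ^+ 2 - boros_moll R m (i - 1) * boros_moll R m (i + 1))
     < (boros_moll R m i ^+ 2 - boros_moll R m (i - 1) * boros_moll R m (i + 1))
       / (boros_moll R m (i + 1) ^+ 2 - boros_moll R m i * boros_moll R m (i + 2))).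
Proof.
have bO : boros_moll R m m.+1%:Z = 0 by rewrite boros_moll_out.
have lcE (j : 'I_m.+1) : lc_op (fun i : 'I_m.+1 => boros_moll R m (i : nat)%:Z) j
    = bm_disc R m (j : nat)%:Z.
  have jm := ltn_ord j.
  by rewrite /lc_op !(@extendE _ _ (boros_moll R m)) //; lia.
split.
- move=> [|[|j]] // _ i i1; have im := ltn_ord i.
    rewrite !(@extendE _ _ (boros_moll R m)) //; try lia.
    by rewrite mulrC; apply/ltW/(@bm_disc_gt0 R m i); lia.
  have DN : bm_disc R m (-1) = 0 by rewrite /bm_disc /= !mul0r expr0n subr0.
  have DO : bm_disc R m m.+1%:Z = 0.
    by rewrite bm_discS bO (@boros_moll_out _ _ m.+2) // mulr0 expr0n subr0.
  rewrite /iter lcE !(@extendE _ _ (bm_disc R m)) //; try lia.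
  have [k kE] : exists k, i = k.+1 :> nat by exists i.-1; lia.
  rewrite kE; have -> : k.+1%:Z + 1 = k.+2%:Z by lia.
  have -> : k.+1%:Z - 1 = k%:Z by lia.
  (* At i = m the right neighbour is the padding zero, and only a square remains. *)
  rewrite subr_ge0 mulrC; have [km|mk] := ltnP k.+1 m; first exact/ltW/bm_disc_lc.
  by rewrite (_ : k.+2 = m.+1) ?DO ?mulr0 ?sqr_ge0 //; lia.
move=> i /andP[i1 im]; have [k ik] : exists k : nat, i = k.+1%:Z by exists `|i - 1|%N; lia.
have km : (k.+1 < m)%N by lia.
have e0 : i - 1 = k%:Z by lia.
have e1 : i + 1 = k.+2%:Z by lia.
have -> : boros_moll R m (i - 1) ^+ 2 - boros_moll R m (i - 2) * boros_moll R m i = bm_disc R m k.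
  by rewrite -e0 /bm_disc; congr (_ - boros_moll _ _ _ * boros_moll _ _ _); lia.
have -> : boros_moll R m (i + 1) ^+ 2 - boros_moll R m i * boros_moll R m (i + 2) = bm_disc R m k.+2.
  by rewrite -e1 /bm_disc; congr (_ - boros_moll _ _ _ * boros_moll _ _ _); lia.
rewrite -/(bm_disc R m i) ik ltr_pdivrMr ?bm_disc_gt0 //; last exact: ltnW.
rewrite mulrAC ltr_pdivlMr ?bm_disc_gt0 // -expr2; exact: bm_disc_lc.
Qed.
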